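(* Composition of $A_\infty$-morphisms is well-defined. That is, if $f:(A,m)\to(A',m')$ and $f':(A',m')\to(A'',m'')$ are morphisms of $A_\infty$-algebras, then the family of maps \[ (f'\circ f)_n:=\sum_{i_1+\dots+i_r=n}(-1)^{l(i_1,\dots,i_r)}f'_r(f_{i_1}\otimes\dots\otimes f_{i_r}),\qquad n\ge1, \] where $l(i_1,\dots,i_r)=\sum_{1\le j<k\le r}(i_k-1)i_j$, is a morphism of $A_\infty$-algebras $f'\circ f:(A,m)\to(A'',m'')$.
   Context: Graded vector spaces are $\mathbb Z$-graded over a field $k$; tensor products of graded maps use the Koszul sign convention $(f\otimes g)(v\otimes w)=(-1)^{|g||v|}f(v)\otimes g(w)$. In sums over $i_1+\dots+i_r=n$, $r\ge1$ and all $i_j\ge1$. An $A_\infty$-algebra $(A,m)$ is a graded vector space $A$ with linear maps $m_n:A^{\otimes n}\to A$ of degree $n-2$, $n\ge1$, such that for all $n\ge1$: $\sum_{r+s+t=n,\ s\ge1,\ r,t\ge0}(-1)^{rs+t}m_{r+t+1}(\mathrm{id}^{\otimes r}\otimes m_s\otimes \mathrm{id}^{\otimes t})=0$. A morphism $f:(A,m)\to(A',m')$ of $A_\infty$-algebras is a family of linear maps $f_n:A^{\otimes n}\to A'$ of degree $n-1$, $n\ge 1$, such that for all $n\ge1$: $\sum_{r+s+t=n}(-1)^{rs+t}f_{r+t+1}(\mathrm{id}^{\otimes r}\otimes m_s\otimes\mathrm{id}^{\otimes t})=\sum_{i_1+\dots+i_r=n}(-1)^{l(i_1,\dots,i_r)}m'_r(f_{i_1}\otimes\dots\otimes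 f_{i_r})$. *)

(* Defs.v *)
From HB Require Import structures.
From mathcomp Require Import all_boot all_algebra.
From mathcomp Require Import boolp.
From mathcomp Require Import generic_quotient ring_quotient.
From mathcomp.multinomials Require Import freeg.

Set Implicit Arguments.
Unset Strict Implicit.
Unset Printing Implicit Defensive.

Import GRing.Theory.
Local Open Scope ring_scope.
Local Open Scope quotient_scope.

(* V = \bigoplus_i V_i (internal direct sum); [gr_homog i] is the subspace V_i. *)
Record gradedSpace (k : fieldType) := GradedSpace {
  gr_sort :> lmodType k;
  gr_homog : int -> gr_sort -> Prop;
  gr_homog0 : forall i, gr_homog i 0;
  gr_homogP : forall i (a : k) u v,
    gr_homog i u -> gr_homog i v -> gr_homog i (a *: u + v);
  gr_decomp : forall v, exists s : seq int * (int -> gr_sort),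
    [/\ uniq s.1, forall i, gr_homog i (s.2 i) & v = \sum_(i <- s.1) s.2 i];
  gr_indep : forall (s : seq int) (c : int -> gr_sort),
    uniq s -> (forall i, gr_homog i (c i)) -> \sum_(i <- s) c i = 0 ->
    forall i, i \in s -> c i = 0
}.

(** * Tensor powers: the free module on n-tuples of vectors, modulo the
      multilinearity relations. *)
Section TensorPower.
Variables (k : fieldType) (V : lmodType k) (n : nat).

Definition upd (v : {ffun 'I_n -> V}) (i : 'I_n) (x : V) : {ffun 'I_n -> V} :=
  [ffun j => if j == i then x else v j].

Definition multilinear (W : lmodType k) (phi : {ffun 'I_n -> V} -> W) : Prop :=
  forall v i, linear (fun x => phi (upd v i x)).

Inductive tens_rel : {freeg {ffun 'I_n -> V} / k} -> Prop :=
| tens_rel0 : tens_rel 0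
| tens_relP (a : k) x y : tens_rel x -> tens_rel y -> tens_rel (a *: x + y)
| tens_rel_gen (a : k) v i x y :
    tens_rel (<< upd v i (a *: x + y) >>
              - (a *: << upd v i x >> + << upd v i y >>)).

Definition tens_relb : {pred {freeg {ffun 'I_n -> V} / k}} :=
  fun x => `[< tens_rel x >].

Fact tens_relb_zmod : zmod_closed tens_relb.
Proof.
split=> [|x y]; rewrite !unfold_in; first exact/asboolP/tens_rel0.
move=> /asboolP hx /asboolP hy; apply/asboolP.
by rewrite addrC -scaleN1r; apply: tens_relP.
Qed.

HB.instance Definition _ := GRing.isZmodClosed.Build _ tens_relb tens_relb_zmod.

Definition tpow := Quotient.quot tens_relb.

HB.instance Definition _ := GRing.Zmodule.on tpow.
HB.instance Definition _ := Quotient.on tpow.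

Fact tens_relbP x y :
  reflect (tens_rel (x - y))
    (\pi_(Quotient.quot tens_relb) x == \pi_(Quotient.quot tens_relb) y).
Proof. by rewrite -Quotient.idealrBE; apply: asboolP. Qed.

Definition tscale (a : k) (x : tpow) : tpow := \pi_tpow (a *: repr x).

Lemma tscale_pi a x : tscale a (\pi_tpow x) = \pi_tpow (a *: x).
Proof.
apply/eqP/tens_relbP; rewrite -scalerBr -[_ *: _]addr0.
apply: tens_relP tens_rel0; apply/tens_relbP/eqP; exact: reprK.
Qed.

Fact tscaleA a b x : tscale a (tscale b x) = tscale (a * b) x.
Proof. by rewrite -[x]reprK !tscale_pi scalerA reprK. Qed.

Fact tscale1 : left_id 1 tscale.
Proof. by move=> x; rewrite -[x]reprK tscale_pi scale1r. Qed.

Fact tpow_piD x y : \pi_tpow (x + y) = \pi_tpow x + \pi_tpow y.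
Proof. exact: (raddfD (\pi_(Quotient.quot tens_relb))). Qed.

Fact tscaleDr : right_distributive tscale +%R.
Proof.
move=> a x y; rewrite -[x]reprK -[y]reprK.
by rewrite -tpow_piD !tscale_pi -tpow_piD scalerDr.
Qed.

Fact tscaleDl x : {morph tscale^~ x : a b / a + b}.
Proof.
move=> a b; rewrite -[x]reprK !tscale_pi scalerDl.
exact: (raddfD (\pi_(Quotient.quot tens_relb))).
Qed.

HB.instance Definition _ :=
  GRing.Zmodule_isLmodule.Build k tpow tscaleA tscale1 tscaleDr tscaleDl.

Lemma tpow_pi_linear : linear (\pi_tpow : _ -> tpow).
Proof.
move=> a x y; rewrite -[a *: \pi_tpow x]/(tscale a _) tscale_pi.
exact: (raddfD (\pi_(Quotient.quot tens_relb))).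
Qed.

(* the pure tensor v_0 \otimes ... \otimes v_(n-1) *)
Definition tpure (v : {ffun 'I_n -> V}) : tpow := \pi_tpow (<< v >>).

Lemma tpure_multilinear : multilinear tpure.
Proof.
move=> v i a x y; rewrite /tpure -tpow_pi_linear.
by apply/eqP/tens_relbP/tens_rel_gen.
Qed.

Lemma tpow_ind (P : tpow -> Prop) :
  P 0 -> (forall a v x, P x -> P (a *: tpure v + x)) -> forall x, P x.
Proof.
move=> P0 PD x; rewrite -[x]reprK -[repr x]freeg_sumE.
elim: (dom _) => [|v s IHs].
  rewrite big_nil (_ : \pi_tpow 0 = 0) //.
  exact: (raddf0 (\pi_(Quotient.quot tens_relb))).
rewrite big_cons; set c := coeff _ _.
have -> : << c *g v >> = c *: << v >> :> {freeg {ffun 'I_n -> V} / k}.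
  by apply/eqP/freeg_eqP => w; rewrite coeffZ !coeffU mul1r.
by rewrite tpow_pi_linear; apply: PD.
Qed.

(* The linear map on the tensor power induced by a multilinear map [phi]. *)
Definition tlift (W : lmodType k) (phi : {ffun 'I_n -> V} -> W) (x : tpow) : W :=
  fglift phi (repr x).

Section Lift.
Variables (W : lmodType k) (phi : {ffun 'I_n -> V} -> W).
Hypothesis phi_lin : multilinear phi.

HB.instance Definition _ := GRing.isZmodMorphism.Build _ _ (fglift phi)
  (lift_is_additive phi).

Let fgliftP : linear (fglift phi).
Proof.
move=> a x y; rewrite (raddfD (fglift phi)); congr (_ + _).
rewrite -{1}[x]freeg_sumE -[in RHS](freeg_sumE x) scaler_sumr.
rewrite !(raddf_sum (fglift phi)) scaler_sumr.
apply: eq_bigr => v _.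
have -> : a *: << coeff v x *g v >> = << a * coeff v x *g v >>
    :> {freeg {ffun 'I_n -> V} / k}.
  by apply/eqP/freeg_eqP => w; rewrite coeffZ !coeffU mulrA.
by rewrite /= !liftU scalerA.
Qed.

Let fglift_rel x : tens_rel x -> fglift phi x = 0.
Proof.
elim=> [|a u v _ hu _ hv|a v i u w]; first exact: raddf0.
  by rewrite fgliftP hu hv scaler0 addr0.
by rewrite raddfB /= -/(fglift phi) fgliftP !liftU !scale1r phi_lin subrr.
Qed.

Lemma tlift_pi x : tlift phi (\pi_tpow x) = fglift phi x.
Proof.
apply/eqP; rewrite -subr_eq0 /tlift -raddfB; apply/eqP/fglift_rel.
exact/tens_relbP/eqP/reprK.
Qed.

Lemma tlift_linear : linear (tlift phi).
Proof.
move=> a x y; rewrite -[x]reprK -[y]reprK -tpow_pi_linear !tlift_pi.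
exact: fgliftP.
Qed.

Lemma tlift_pure v : tlift phi (tpure v) = phi v.
Proof. by rewrite tlift_pi liftU scale1r. Qed.

End Lift.
End TensorPower.

(** * Concatenation, reindexing and grading of tensor powers *)

Definition fcat (T : Type) p q (v : {ffun 'I_p -> T}) (w : {ffun 'I_q -> T}) :
    {ffun 'I_(p + q) -> T} :=
  [ffun i => match split i with inl j => v j | inr j => w j end].

(* the canonical map V^{\otimes p} \otimes V^{\otimes q} -> V^{\otimes (p + q)} *)
Definition tcat (k : fieldType) (V : lmodType k) p q
    (x : tpow V p) (y : tpow V q) : tpow V (p + q) :=
  tlift (fun v => tlift (fun w => tpure (fcat v w)) y) x.

(* The identification of V^{\otimes p} with V^{\otimes q} when p = q; it is only
   ever applied in that case (its value is 0 otherwise). *)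
Definition tpow_cast (k : fieldType) (V : lmodType k) p q (x : tpow V p) : tpow V q :=
  if @eqP _ p q is ReflectT e then ecast n (tpow V n) e x else 0.

(* the identification of V with V^{\otimes 1} *)
Definition tone (k : fieldType) (V : lmodType k) (x : V) : tpow V 1 :=
  tpure [ffun => x].

(* (A^{\otimes n})_d is spanned by the pure tensors of homogeneous vectors whose
   degrees add up to d. *)
Inductive tpow_homog (k : fieldType) (A : gradedSpace k) n (d : int) :
    tpow A n -> Prop :=
| tpow_homog0 : tpow_homog d 0
| tpow_homogP (a : k) x y :
    tpow_homog d x -> tpow_homog d y -> tpow_homog d (a *: x + y)
| tpow_homog_pure (e : 'I_n -> int) (v : {ffun 'I_n -> A}) :
    (forall i, gr_homog (e i) (v i)) -> \sum_i e i = d ->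
    tpow_homog d (tpure v).

Definition has_degree (k : fieldType) (A B : gradedSpace k) n
    (f : tpow A n -> B) (d : int) : Prop :=
  forall e x, tpow_homog e x -> gr_homog (e + d) (f x).

(** * Koszul tensor product of graded maps *)

(* The linear map v |-> (-1)^(d |v|) v. *)
Definition koszul (k : fieldType) (A : gradedSpace k) (d : int) (v : A) : A :=
  let s := sval (cid (gr_decomp v)) in
  \sum_(i <- s.1) (-1) ^ (d * i) *: s.2 i.

(* [gtens f d g] is f \otimes g for g of degree d, that is,
   v \otimes w |-> (-1)^(d |v|) f(v) \otimes g(w); on a pure tensor v the sign
   (-1)^(d |v|) is spread over the factors of v. *)
Definition gtens (k : fieldType) (A : gradedSpace k) (W : lmodType k) p q p' q'
    (f : tpow A p -> tpow W p') (d : int) (g : tpow A q -> tpow W q') :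
    tpow A (p + q) -> tpow W (p' + q') :=
  tlift (fun v : {ffun 'I_(p + q) -> A} =>
    tcat (f (tpure [ffun i => koszul d (v (lshift q i))]))
         (g (tpure [ffun i => v (rshift p i)]))).

Section KoszulTheory.
Variables (k : fieldType) (A : gradedSpace k).
Implicit Types (d i : int) (u v : A).

Let ext (r : seq int) (b : int -> A) i := if i \in r then b i else 0.

Let ext_homog r b :
  (forall i, gr_homog i (b i)) -> forall i, gr_homog i (ext r b i).
Proof. by move=> hb i; rewrite /ext; case: ifP => // _; apply: gr_homog0. Qed.

Let ext_sum (F : int -> A -> A) (r t : seq int) (b : int -> A) :
  uniq r -> uniq t -> {subset r <= t} -> (forall i, F i 0 = 0) ->
  \sum_(i <- r) F i (b i) = \sum_(i <- t) F i (ext r b i).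
Proof.
move=> ur ut rt F0; rewrite [RHS](bigID (mem r)) /=.
rewrite [X in _ = _ + X]big1 => [|i ir]; last by rewrite /ext (negbTE ir).
rewrite addr0 -[RHS]big_filter (perm_big [seq i <- t | i \in r]) /=.
  by apply: eq_big_seq => i; rewrite mem_filter /ext => /andP[->].
apply: uniq_perm => //; first by rewrite filter_uniq.
by move=> i; rewrite mem_filter; case ir: (i \in r) => //=; rewrite rt.
Qed.

Lemma koszulE d v (s : seq int) (c : int -> A) :
  uniq s -> (forall i, gr_homog i (c i)) -> v = \sum_(i <- s) c i ->
  koszul d v = \sum_(i <- s) (-1) ^ (d * i) *: c i.
Proof.
rewrite /koszul; case: (cid _) => -[s0 c0] [/= us0 hc0 ->] us hc Ev.
pose t := undup (s0 ++ s); have ut : uniq t by exact: undup_uniq.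
have s0t : {subset s0 <= t} by move=> i; rewrite mem_undup mem_cat => ->.
have st : {subset s <= t}.
  by move=> i; rewrite mem_undup mem_cat => ->; rewrite orbT.
have E i : i \in t -> ext s0 c0 i = ext s c i.
  move=> it; apply/eqP; rewrite -subr_eq0; apply/eqP.
  apply: (@gr_indep _ _ t (fun i => ext s0 c0 i - ext s c i)) it => //.
    by move=> j; rewrite addrC -scaleN1r; apply: gr_homogP; apply: ext_homog.
  rewrite sumrB -(@ext_sum (fun=> id) s0 t) // -(@ext_sum (fun=> id) s t) //.
  by rewrite Ev subrr.
pose F i x : A := (-1) ^ (d * i) *: x.
have F0 i : F i 0 = 0 by rewrite /F scaler0.
rewrite (@ext_sum F s0 t) // (@ext_sum F s t) //.
by apply: eq_big_seq => i /E ->.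
Qed.

Lemma koszul_homog d i v : gr_homog i v -> koszul d v = (-1) ^ (d * i) *: v.
Proof.
move=> hv; pose c j := if j == i then v else 0.
rewrite (@koszulE d v [:: i] c) ?big_seq1 /c ?eqxx // => j.
by case: eqP => [->|_] //; apply: gr_homog0.
Qed.

Lemma koszul_linear d : linear (@koszul k A d).
Proof.
move=> a u v.
have [[s b] [/= us hb Eu]] := gr_decomp u; have [[r c] [/= ur hc Ev]] := gr_decomp v.
pose t := undup (s ++ r); have ut : uniq t by exact: undup_uniq.
have st : {subset s <= t} by move=> i; rewrite mem_undup mem_cat => ->.
have rt : {subset r <= t}.
  by move=> i; rewrite mem_undup mem_cat => ->; rewrite orbT.
rewrite (@ext_sum (fun=> id) s t) // in Eu.
rewrite (@ext_sum (fun=> id) r t) // in Ev.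
rewrite (koszulE d ut (ext_homog s hb) Eu) (koszulE d ut (ext_homog r hc) Ev).
rewrite (@koszulE d _ t (fun i => a *: ext s b i + ext r c i)) //.
- rewrite scaler_sumr -big_split; apply: eq_bigr => i _ /=.
  by rewrite scalerDr !scalerA mulrC.
- by move=> i; apply: gr_homogP; apply: ext_homog.
- by rewrite Eu Ev scaler_sumr -big_split.
Qed.
End KoszulTheory.

Section TcatTheory.
Variables (k : fieldType) (V : lmodType k) (p q : nat).

Let fcatr_upd (v : {ffun 'I_p -> V}) (w : {ffun 'I_q -> V}) i x :
  fcat v (upd w i x) = upd (fcat v w) (rshift p i) x.
Proof.
apply/ffunP => j; rewrite !ffunE; case: splitP => j' Ej; rewrite -?val_eqE /= ?Ej.
  by rewrite ltn_eqF // ltn_addr.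
by rewrite ffunE eqn_add2l.
Qed.

Let fcatl_upd (v : {ffun 'I_p -> V}) (w : {ffun 'I_q -> V}) i x :
  fcat (upd v i x) w = upd (fcat v w) (lshift q i) x.
Proof.
apply/ffunP => j; rewrite !ffunE; case: splitP => j' Ej; rewrite -?val_eqE /= ?Ej.
  by rewrite ffunE.
by rewrite gtn_eqF // ltn_addr.
Qed.

Let tcatr (v : {ffun 'I_p -> V}) : multilinear (fun w => tpure (fcat v w)) (n := q).
Proof. by move=> w i a x y; rewrite !fcatr_upd tpure_multilinear. Qed.

Let tcatl (y : tpow V q) :
  multilinear (fun v : {ffun 'I_p -> V} => tlift (fun w => tpure (fcat v w)) y).
Proof.
move=> v i a u w; elim/tpow_ind: y => [|b z y IHy].
  have l0 (v' : {ffun 'I_p -> V}) : tlift (fun w => tpure (fcat v' w)) (0 : tpow V q) = 0.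
    have := tlift_linear (@tcatr v') (-1) 0 0.
    by rewrite scaler0 addr0 scaleN1r addNr.
  by rewrite !l0 scaler0 addr0.
rewrite !(tlift_linear (@tcatr _)) !(tlift_pure (@tcatr _)) IHy.
rewrite !fcatl_upd tpure_multilinear !scalerDr !scalerA mulrC -!addrA.
by congr (_ + _); rewrite addrCA.
Qed.

Lemma tcat_pure (v : {ffun 'I_p -> V}) (w : {ffun 'I_q -> V}) :
  tcat (tpure v) (tpure w) = tpure (fcat v w).
Proof. by rewrite /tcat (tlift_pure (@tcatl _)) (tlift_pure (@tcatr _)). Qed.

Lemma tcat_linearl (y : tpow V q) : linear (fun x : tpow V p => tcat x y).
Proof. exact: tlift_linear (@tcatl y). Qed.

Lemma tcat_linearr (x : tpow V p) : linear (fun y : tpow V q => tcat x y).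
Proof.
move=> a y z; elim/tpow_ind: x => [|b v x IHx].
  have l0 (y' : tpow V q) : tcat (0 : tpow V p) y' = 0 :> tpow V (p + q).
    have := @tcat_linearl y' (-1) 0 0.
    by rewrite scaler0 addr0 scaleN1r addNr.
  by rewrite !l0 scaler0 addr0.
rewrite !tcat_linearl IHx /tcat !(tlift_pure (@tcatl _)) (tlift_linear (@tcatr _)).
by rewrite !scalerDr !scalerA mulrC -!addrA; congr (_ + _); rewrite addrCA.
Qed.
End TcatTheory.

Section GtensTheory.
Variables (k : fieldType) (A : gradedSpace k) (W : lmodType k) (p q p' q' : nat).
Variables (f : tpow A p -> tpow W p') (d : int) (g : tpow A q -> tpow W q').
Hypotheses (f_lin : linear f) (g_lin : linear g).

Let phi (v : {ffun 'I_(p + q) -> A}) :=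
  tcat (f (tpure [ffun i => koszul d (v (lshift q i))]))
       (g (tpure [ffun i => v (rshift p i)])).

Let phi_multilinear : multilinear phi.
Proof.
move=> v i a x y; rewrite /phi.
have [j ->|j ->] := split_ordP i.
  have El z : [ffun i0 => koszul d (upd v (lshift q j) z (lshift q i0))]
    = upd [ffun i0 => koszul d (v (lshift q i0))] j (koszul d z).
    apply/ffunP => i0; rewrite !ffunE eq_lshift; by case: eqP.
  have Er z : [ffun i0 => upd v (lshift q j) z (rshift p i0)]
    = [ffun i0 => v (rshift p i0)] by apply/ffunP => i0; rewrite !ffunE eq_rlshift.
  by rewrite !El !Er koszul_linear tpure_multilinear f_lin tcat_linearl.
have Er z : [ffun i0 => upd v (rshift p j) z (rshift p i0)]
  = upd [ffun i0 => v (rshift p i0)] j z.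
  by apply/ffunP => i0; rewrite !ffunE eq_rshift.
have El z : [ffun i0 => koszul d (upd v (rshift p j) z (lshift q i0))]
  = [ffun i0 => koszul d (v (lshift q i0))].
  by apply/ffunP => i0; rewrite !ffunE eq_lrshift.
by rewrite !El !Er tpure_multilinear g_lin tcat_linearr.
Qed.

Lemma gtens_linear : linear (gtens f d g).
Proof. exact: tlift_linear phi_multilinear. Qed.

Let lin0 (U U' : lmodType k) (h : U -> U') : linear h -> h 0 = 0.
Proof. by move=> /(_ (-1) 0 0); rewrite scaler0 addr0 scaleN1r addNr. Qed.

Let pure_scale (c : 'I_p -> k) (v : {ffun 'I_p -> A}) :
  tpure [ffun i => c i *: v i] = (\prod_i c i) *: tpure v.
Proof.
pose h (s : seq 'I_p) := [ffun i => (if i \in s then c i else 1) *: v i].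
have hs (s : seq 'I_p) : uniq s -> tpure (h s) = (\prod_(i <- s) c i) *: tpure v.
  elim: s => [_|i s IHs /= /andP[is_ us]].
    rewrite big_nil scale1r; congr tpure.
    by apply/ffunP => i; rewrite ffunE scale1r.
  rewrite big_cons -scalerA -IHs //.
  have -> : h (i :: s) = upd (h s) i (c i *: v i + 0).
    apply/ffunP => j; rewrite !ffunE inE addr0; case: eqP => [->|] //=.
  rewrite tpure_multilinear (_ : upd (h s) i (v i) = h s).
    rewrite (_ : tpure (upd _ i 0) = 0) ?addr0 //.
    have := tpure_multilinear (h s) i (-1) 0 0.
    by rewrite scaler0 addr0 scaleN1r addNr.
  apply/ffunP => j; rewrite !ffunE; case: eqP => // ->.
  by rewrite (negbTE is_) scale1r.
rewrite -(hs (index_enum _)) ?index_enum_uniq //; congr tpure.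
by apply/ffunP => i; rewrite !ffunE mem_index_enum.
Qed.

Lemma gtens_koszul (e : int) (x : tpow A p) (y : tpow A q) : tpow_homog e x ->
  gtens f d g (tcat x y) = (-1) ^ (d * e) *: tcat (f x) (g y).
Proof.
elim=> [|a u v _ IHu _ IHv|ev v hv <-].
- rewrite (lin0 f_lin) (lin0 (@tcat_linearl _ _ _ _ y)).
  rewrite (lin0 (@tcat_linearl _ _ _ _ (g y))).
  by rewrite scaler0; apply: lin0 gtens_linear.
- rewrite f_lin tcat_linearl gtens_linear IHu IHv tcat_linearl.
  by rewrite scalerDr !scalerA mulrC.
elim/tpow_ind: y => [|b w y IHy].
  rewrite (lin0 g_lin) (lin0 (@tcat_linearr _ _ _ _ _)) (lin0 (@tcat_linearr _ _ _ _ _)).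
  by rewrite scaler0; apply: lin0 gtens_linear.
rewrite g_lin !tcat_linearr gtens_linear IHy scalerDr; congr (_ + _).
rewrite tcat_pure /gtens (tlift_pure phi_multilinear) /phi.
have -> : [ffun i => fcat v w (rshift p i)] = w.
  by apply/ffunP => i; rewrite !ffunE (unsplitK (inr i)).
have -> : [ffun i => koszul d (fcat v w (lshift q i))]
    = [ffun i => (-1) ^ (d * ev i) *: v i].
  by apply/ffunP => i; rewrite !ffunE (unsplitK (inl i)) (koszul_homog d (hv i)).
rewrite pure_scale -[_ *: tpure v]addr0 f_lin (lin0 f_lin) tcat_linearl.
rewrite (lin0 (@tcat_linearl _ _ _ _ _)) addr0 !scalerA mulrC; congr (_ * _ *: _).
rewrite mulr_sumr; elim/big_rec2: _ => [|i z1 z2 _ ->]; first by rewrite expr0z.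
by rewrite expfzDr // oppr_eq0 oner_eq0.
Qed.
End GtensTheory.

(* id^{\otimes r} \otimes g \otimes id^{\otimes t} for g : A^{\otimes s} -> A of
   degree d *)
Definition tens_insert (k : fieldType) (A : gradedSpace k) r s t (d : int)
    (g : tpow A s -> A) : tpow A (r + (s + t)) -> tpow A (r + (1 + t)) :=
  gtens (@id (tpow A r)) d (gtens (fun x => tone (g x)) 0 (@id (tpow A t))).

Arguments tens_insert {k A} r s t d g _.

(* f_(i_1) \otimes ... \otimes f_(i_r) for the sequence [:: i_1; ...; i_r], where
   f_n has degree n - 1; the empty tensor product is the identity of k. *)
Section TensSeq.
Variables (k : fieldType) (A B : gradedSpace k) (f : forall n, tpow A n -> B).

Fixpoint tens_seq (i : seq nat) : tpow A (sumn i) -> tpow B (size i) :=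
  match i with
  | [::] => tlift (fun=> tpure [ffun=> 0])
  | i1 :: i' => gtens (fun x => tone (@f i1 x)) (\sum_(j <- i') (j%:Z - 1))
                      (@tens_seq i')
  end.

End TensSeq.
Arguments tens_seq {k A B} f i _.

(** * A-infinity algebras and their morphisms
      In a family indexed by [nat], the component of index 0 is never used. *)

(* \sum_(r + s + t = n) (-1)^(rs + t) g_(r+1+t) (id^r \otimes m_s \otimes id^t) *)
Definition stasheff_sum (k : fieldType) (A : gradedSpace k) (W : lmodType k)
    (m : forall n, tpow A n -> A) (g : forall n, tpow A n -> W) n (x : tpow A n) :
    W :=
  \sum_(r < n.+1) \sum_(s < n.+1) \sum_(t < n.+1 | (0 < s)%N && (r + s + t == n)%N)
    (-1) ^+ (r * s + t)%N *:
      g (r + (1 + t))%N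
        (tens_insert r s t (s%:Z - 2) (m s) (tpow_cast (r + (s + t))%N x)).

(* l(i_1, ..., i_r) = \sum_(j < k) (i_k - 1) i_j *)
Definition lsign (i : seq nat) : nat :=
  (\sum_(k < size i) \sum_(j < size i | j < k) (nth 0 i k).-1 * nth 0 i j)%N.

(* \sum_(i_1 + ... + i_r = n) (-1)^l g_r (f_(i_1) \otimes ... \otimes f_(i_r)) *)
Definition ainf_comp (k : fieldType) (A B : gradedSpace k) (W : lmodType k)
    (g : forall n, tpow B n -> W) (f : forall n, tpow A n -> B) n (x : tpow A n) :
    W :=
  \sum_(r < n.+1 | (0 < r)%N)
   \sum_(c : r.-tuple 'I_n.+1 |
         let i := [seq val j | j <- c] in all (leq 1) i && (sumn i == n))
    let i := [seq val j | j <- c] in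
    (-1) ^+ lsign i *: g (size i) (tens_seq f i (tpow_cast (sumn i) x)).

Definition is_ainf_algebra (k : fieldType) (A : gradedSpace k)
    (m : forall n, tpow A n -> A) : Prop :=
  (forall n, (1 <= n)%N -> linear (m n) /\ has_degree (m n) (n%:Z - 2)) /\
  (forall n, (1 <= n)%N -> forall x : tpow A n, stasheff_sum m m x = 0).

Definition is_ainf_morphism (k : fieldType) (A B : gradedSpace k)
    (m : forall n, tpow A n -> A) (m' : forall n, tpow B n -> B)
    (f : forall n, tpow A n -> B) : Prop :=
  (forall n, (1 <= n)%N -> linear (f n) /\ has_degree (f n) (n%:Z - 1)) /\
  (forall n, (1 <= n)%N -> forall x : tpow A n,
     stasheff_sum m f x = ainf_comp m' f x).

(* Main.v *)
Require Import Defs.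
From mathcomp Require Import all_boot all_algebra.
From mathcomp Require Import boolp zify.

(* The signs disappear after suspension: evaluated on words of vectors twisted by
   suitable powers of the automorphism sgn x = (-1)^(|x| + 1) x, the maps m_n, f_n
   become multilinear functions m, f on words for which the A-infinity equations
   read [coder m f = fstar f m'] and composition is [fstar f f'].  Here [coder m]
   and [fstar f] are the operators on multilinear functions of words that are
   dual to the coderivation and to the coalgebra morphism induced by m and f.
   The theorem then follows from [coder m (fstar f g) = fstar f (coder m' g)] and
   [fstar (fstar f f') g = fstar f (fstar f' g)]. *)

Set Implicit Arguments.
Unset Strict Implicit.
Unset Printing Implicit Defensive.

Import GRing.Theory.
Local Open Scope ring_scope.

(** * Sums over factorizations of words *)

Lemma linear_at0 (k : pzRingType) (U U' : lmodType k) (h : U -> U') : linear h -> h 0 = 0.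
Proof. by move=> /(_ (-1) 0 0); rewrite scaler0 addr0 scaleN1r addNr. Qed.

Lemma linear_add (k : pzRingType) (U U' : lmodType k) (h : U -> U') :
  linear h -> {morph h : x y / x + y}.
Proof. by move=> hl x y; have := hl 1 x y; rewrite !scale1r. Qed.

Lemma linear_scale (k : pzRingType) (U U' : lmodType k) (h : U -> U') :
  linear h -> forall a x, h (a *: x) = a *: h x.
Proof. by move=> hl a x; have := hl a x 0; rewrite (linear_at0 hl) !addr0. Qed.

Section SplitSum.
Variables (T : Type) (W : nmodType).
Implicit Types (F G : seq T -> seq T -> W) (w : seq T).

(** Evaluation of [F] on the deconcatenation coproduct of [w], both trivial cuts included; [ssum1]
    keeps the cuts with nonempty left part. *)
Fixpoint ssum F w : W :=
  if w is x :: w' then F [::] w + ssum (fun u v => F (x :: u) v) w'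
  else F [::] [::].

Definition ssum1 F w : W :=
  if w is x :: w' then ssum (fun u v => F (x :: u) v) w' else 0.

Lemma ssumE F w : ssum F w = F [::] w + ssum1 F w.
Proof. by case: w => //=; rewrite addr0. Qed.

Lemma eq_ssum F G w :
  (forall u v, u ++ v = w -> F u v = G u v) -> ssum F w = ssum G w.
Proof.
elim: w F G => [|x w IHw] F G FG /=; first exact: FG.
by rewrite FG //; congr (_ + _); apply: IHw => u v uv; apply: FG; rewrite /= uv.
Qed.

Lemma eq_ssum1 F G w :
  (forall x u v, (x :: u) ++ v = w -> F (x :: u) v = G (x :: u) v) ->
  ssum1 F w = ssum1 G w.
Proof.
by case: w => //= x w FG; apply: eq_ssum => u v uv; apply: FG; rewrite /= uv.
Qed.

Lemma ssum0 w : ssum (fun _ _ => 0) w = 0.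
Proof. by elim: w => //= x w ->; rewrite addr0. Qed.

Lemma ssumD F G w : ssum (fun u v => F u v + G u v) w = ssum F w + ssum G w.
Proof. by elim: w F G => //= x w IHw F G; rewrite IHw addrACA. Qed.

Lemma ssum1D F G w : ssum1 (fun u v => F u v + G u v) w = ssum1 F w + ssum1 G w.
Proof. by case: w => [|x w] /=; rewrite ?addr0 ?ssumD. Qed.

(** The cut falls either before the marked letter [x] or after it. *)
Lemma ssum1_cat F a x c :
  ssum1 F (a ++ x :: c) =
  ssum1 (fun u v => F u (v ++ x :: c)) a + ssum (fun p q => F (a ++ x :: p) q) c.
Proof.
elim: a F => [|y a IHa] F /=; first by rewrite add0r.
rewrite ssumE (IHa (fun u v => F (y :: u) v)) addrA; congr (_ + _).
by rewrite [RHS]ssumE.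
Qed.

(** Coassociativity of deconcatenation: both sides run over the ways of cutting [w] into three
    words. *)
Lemma ssum_assoc (F : seq T -> seq T -> seq T -> W) w :
  ssum (fun a r => ssum (F a) r) w =
  ssum (fun s q => ssum (fun a b => F a b q) s) w.
Proof.
elim: w F => //= x w IHw F; rewrite (IHw (fun a => F (x :: a))) -addrA -ssumD.
by congr (_ + _).
Qed.

Lemma ssum_assoc1 (F : seq T -> seq T -> seq T -> W) w :
  ssum1 (fun a r => ssum (F a) r) w =
  ssum1 (fun s q => ssum1 (fun a b => F a b q) s) w.
Proof. by case: w => //= x w; rewrite ssum_assoc. Qed.

Lemma ssum1_ssum (F : seq T -> seq T -> seq T -> W) w :
  ssum1 (fun a r => ssum (F a) r) w =
  ssum (fun s q => ssum1 (fun a b => F a b q) s) w.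
Proof. by rewrite ssum_assoc1 [RHS]ssumE add0r. Qed.

Lemma exchange_ssum1 (F : seq T -> seq T -> seq T -> seq T -> W) w w' :
  ssum1 (fun a b => ssum1 (F a b) w') w =
  ssum1 (fun u v => ssum1 (fun a b => F a b u v) w) w'.
Proof.
case: w => [|x w] /=; first by case: w' => //= y w'; rewrite ssum0.
case: w' => [|y w'] /=; first by rewrite ssum0.
suff E (G : seq T -> seq T -> seq T -> seq T -> W) :
    ssum (fun a b => ssum (fun u v => G a b (y :: u) v) w') w =
    ssum (fun u v => ssum (fun a b => G a b (y :: u) v) w) w'.
  exact: (E (fun a => F (x :: a))).
elim: w G => //= z w IHw G.
by rewrite ssumD (IHw (fun a => G (z :: a))).
Qed.

End SplitSum.

Lemma ssum1_map (T T' : Type) (W : nmodType) (h : T -> T') F w :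
  ssum1 F (map h w) = ssum1 (fun u v => F (map h u) (map h v)) w :> W.
Proof.
suff sm G : ssum G (map h w) = ssum (fun u v => G (map h u) (map h v)) w :> W.
  (* Extending [F] by [0] to an empty left part turns [ssum1] into [ssum], for which induction on
     [w] is direct. *)
  have := sm (fun u v => if u is _ :: _ then F u v else 0).
  rewrite !ssumE !add0r => E; transitivity (ssum1 (fun u v : seq T' =>
    if u is _ :: _ then F u v else 0) (map h w)).
    exact: eq_ssum1.
  by rewrite E; apply: eq_ssum1.
by elim: w G => //= x w IHw G; rewrite IHw.
Qed.

Lemma ssum1_linear (k : pzRingType) (T : Type) (U U' : lmodType k) (h : U -> U') F
    (w : seq T) :
  linear h -> h (ssum1 F w) = ssum1 (fun u v => h (F u v)) w.
Proof.
move=> hl; case: w => [|x w] /=; first exact: linear_at0.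
elim: w F x => //= y w IHw F x; rewrite (linear_add hl); congr (_ + _).
exact: (IHw (fun u v => F (x :: u) v)).
Qed.

Lemma ssum_linear (k : pzRingType) (T : Type) (U U' : lmodType k) (h : U -> U') F
    (w : seq T) :
  linear h -> h (ssum F w) = ssum (fun u v => h (F u v)) w.
Proof.
by move=> hl; rewrite !ssumE (linear_add hl) (ssum1_linear _ _ hl).
Qed.

(** * Factorizations into nonempty blocks *)

Section BlockSum.
Variables (T T' : Type) (W : nmodType) (f : seq T -> T').
Implicit Types (g : seq T' -> W) (w : seq T).

Fixpoint blk g (u w : seq T) : W :=
  if w is x :: w' then
    blk g (rcons u x) w' + blk (fun z => g (f u :: z)) [:: x] w'
  else g [:: f u].

(* The sum of g (f u_1, ..., f u_r) over the factorizations w = u_1 ... u_r into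
   nonempty words. *)
Definition fstar g w : W := if w is x :: w' then blk g [:: x] w' else g [::].

(** Sorts the terms by the word [a] that still joins the open block before it closes. *)
Lemma blkE g u w :
  blk g u w = ssum (fun a v => fstar (fun z => g (f (u ++ a) :: z)) v) w.
Proof.
elim: w g u => [|x w IHw] g u /=; first by rewrite cats0.
rewrite cats0 addrC; congr (_ + _); rewrite IHw.
by apply: eq_ssum => a v _; rewrite cat_rcons.
Qed.

Lemma fstarE g x w :
  fstar g (x :: w) = ssum1 (fun u v => fstar (fun z => g (f u :: z)) v) (x :: w).
Proof. by rewrite /= blkE. Qed.

Lemma fstarD g1 g2 w : fstar (fun z => g1 z + g2 z) w = fstar g1 w + fstar g2 w.
Proof.
case: w => //= x w; elim: w g1 g2 [:: x] => //= y w IHw g1 g2 u.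
by rewrite !IHw addrACA.
Qed.

(** Every factorization of a nonempty word has at least one block, so the values at [[::]] never
    enter. *)
Lemma eq_fstar1 g1 g2 x w :
  (forall y z, g1 (y :: z) = g2 (y :: z)) -> fstar g1 (x :: w) = fstar g2 (x :: w).
Proof.
move=> E /=; elim: w g1 g2 [:: x] E => //= y w IHw g1 g2 u E.
by rewrite (IHw _ _ _ E); congr (_ + _); apply: IHw.
Qed.

(** Dual of being a coalgebra morphism: cutting a list of blocks amounts to cutting the word at a
    block boundary and factorizing both sides. *)
Lemma fstar_ssum (H : seq T' -> seq T' -> W) w :
  fstar (fun z => ssum H z) w = ssum (fun v q => fstar (fun b => fstar (H b) q) v) w.
Proof.
have [n] := ubnP (size w); elim: n H w => // n IHn H [//|x w] szw.
rewrite [RHS]ssumE {1}(_ : (fun z => ssum H z) = fun z => H [::] z + ssum1 H z).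
  rewrite fstarD; congr (_ + _); rewrite fstarE.
  transitivity (ssum1 (fun u s => ssum (fun v q =>
      fstar (fun b => fstar (H (f u :: b)) q) v) s) (x :: w)).
    apply: eq_ssum1 => y u v uv; apply: IHn.
    by rewrite -uv /= size_cat ltnS in szw; apply: leq_ltn_trans szw; apply: leq_addl.
  rewrite (ssum_assoc1 (fun u v q => fstar (fun b => fstar (H (f u :: b)) q) v)).
  by apply: eq_ssum1 => y u v _; rewrite [RHS]fstarE.
by apply/funext => z; rewrite ssumE.
Qed.

Lemma fstar_ssum1 (H : seq T' -> seq T' -> W) w :
  fstar (fun z => ssum1 H z) w =
  ssum1 (fun v q => fstar (fun b => fstar (H b) q) v) w.
Proof.
pose H' b c := if b is _ :: _ then H b c else 0.
have E z : ssum H' z = ssum1 H z.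
  by rewrite ssumE add0r; apply: eq_ssum1.
rewrite -(funext E) fstar_ssum ssumE /=.
have -> : fstar (H' [::]) w = 0.
  case: w => //= x w; rewrite /H'.
  by elim: w [:: x] => //= y w IHw u; rewrite !IHw addr0.
by rewrite add0r; apply: eq_ssum1 => x u v _; apply: eq_fstar1.
Qed.

(** Sorts the terms by the first block, which either ends before [x] or contains it. *)
Lemma fstar_cat g a x c :
  fstar g (a ++ x :: c) =
  ssum1 (fun u v => fstar (fun z => g (f u :: z)) (v ++ x :: c)) a +
  ssum (fun p q => fstar (fun z => g (f (a ++ x :: p) :: z)) q) c.
Proof.
rewrite -(ssum1_cat (fun u v => fstar (fun z => g (f u :: z)) v)).
by case: a => [|y a]; rewrite [LHS]fstarE.
Qed.

End BlockSum.

Lemma eq_fstar (T T' : Type) (W : nmodType) (f1 f2 : seq T -> T') (g : seq T' -> W) w :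
  (forall x u, f1 (x :: u) = f2 (x :: u)) -> fstar f1 g w = fstar f2 g w.
Proof.
move=> E; case: w => //= x w; elim: w g x [::] => [|y w IHw] g x u /=.
  by rewrite E.
by rewrite E IHw; congr (_ + _); apply: IHw.
Qed.

Section BlockLinear.
Variables (k : comPzRingType) (T T' : Type) (f : seq T -> T').

Lemma fstar_linear (U W : lmodType k) (h : U -> W) (g : seq T' -> U) w :
  linear h -> h (fstar f g w) = fstar f (h \o g) w.
Proof.
move=> hl; case: w => //= x w; elim: w g [:: x] => //= y w IHw g u.
by rewrite (linear_add hl) !IHw.
Qed.

Lemma fstarP (W : lmodType k) (g1 g2 : seq T' -> W) a w :
  fstar f (fun z => a *: g1 z + g2 z) w = a *: fstar f g1 w + fstar f g2 w.
Proof.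
rewrite (fstarD f (fun z => a *: g1 z) g2); congr (_ + _).
by rewrite (fstar_linear (h := *:%R a)) // => b x y; rewrite scalerDr !scalerA mulrC.
Qed.
End BlockLinear.

(** * Multilinear functions of words and coderivations *)

Section Derivation.
Variables (k : comPzRingType) (A W : lmodType k).

Definition wmultilinear (g : seq A -> W) : Prop :=
  forall u v, linear (fun x => g (u ++ x :: v)).

Lemma wmultilinear_cons g x : wmultilinear g -> wmultilinear (fun z => g (x :: z)).
Proof. by move=> gl u v; apply: (gl (x :: u)). Qed.

Lemma fstar_cons_linear T (f : seq T -> A) g w :
  wmultilinear g -> linear (fun x => fstar f (fun z => g (x :: z)) w).
Proof.
move=> gl a x y; rewrite -fstarP; congr (fstar f _ w); apply/funext => z.
exact: (gl [::] z).
Qed.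

End Derivation.

Section Coderivation.
Variables (k : comPzRingType) (A : lmodType k) (s : A -> A).

(* The pullback of g along the coderivation of the tensor coalgebra induced by m;
   s is the sign automorphism. *)
Definition coder (W : nmodType) (m : seq A -> A) (g : seq A -> W) (w : seq A) : W :=
  ssum (fun a r => ssum1 (fun b c => g (map s a ++ m b :: c)) r) w.

Lemma coder_cons (W : nmodType) m (g : seq A -> W) x w :
  coder m g (x :: w) =
  ssum1 (fun b c => g (m b :: c)) (x :: w) + coder m (fun z => g (s x :: z)) w.
Proof. by []. Qed.

Lemma eq_coder (W : nmodType) m m' (g g' : seq A -> W) w :
  (forall x u, m (x :: u) = m' (x :: u)) ->
  (forall x u, g (x :: u) = g' (x :: u)) -> coder m g w = coder m' g' w.
Proof.
move=> Em Eg; apply: eq_ssum => a r _; apply: eq_ssum1 => x u v _.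
by rewrite Em; case: a => [|y a] /=; rewrite Eg.
Qed.

End Coderivation.

(* A morphism of tensor coalgebras whose corestriction to B intertwines the
   coderivations intertwines them altogether. *)
Lemma coder_fstar (k : comPzRingType) (A B W : lmodType k) (sA : A -> A) (sB : B -> B)
    (m : seq A -> A) (m' : seq B -> B) (f : seq A -> B) (g : seq B -> W) w :
  (forall x u, f (map sA (x :: u)) = sB (f (x :: u))) ->
  (forall x u, coder sA m f (x :: u) = fstar f m' (x :: u)) ->
  wmultilinear g ->
  coder sA m (fstar f g) w = fstar f (coder sB m' g) w.
Proof.
move=> fs fm; have [n] := ubnP (size w).
elim: n g w => // n IHn g [//|x w] szw gl.
pose G y q := fstar f (fun z => g (y :: z)) q.
(* The first block either precedes the inserted [m b], so that it only acquires the sign [sB] and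
   induction treats the rest, or contains it, which yields [coder sA m f] on that block. *)
transitivity (
  ssum1 (fun u r => fstar f (coder sB m' (fun z => g (sB (f u) :: z))) r) (x :: w)
   + ssum1 (fun v q => G (coder sA m f v) q) (x :: w)).
  rewrite /coder.
  transitivity (ssum (fun a r => ssum1 (fun b c =>
      ssum1 (fun u v => G (sB (f u)) (map sA v ++ m b :: c)) a) r
    + ssum1 (fun b c => ssum (fun p q => G (f (map sA a ++ m b :: p)) q) c) r) (x :: w)).
    apply: eq_ssum => a r _; rewrite -ssum1D; apply: eq_ssum1 => y u v _.
    rewrite fstar_cat ssum1_map; congr (_ + _).
    by apply: eq_ssum1 => y' u' v' _; rewrite fs.
  rewrite ssumD; congr (_ + _).
    under eq_ssum => a r _ do rewrite exchange_ssum1.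
    rewrite -(ssum1_ssum (fun u v r => ssum1 (fun b c =>
      G (sB (f u)) (map sA v ++ m b :: c)) r)).
    apply: eq_ssum1 => y u v uv.
    have szv : (size v < n)%N.
      by rewrite -uv /= size_cat ltnS in szw; apply: leq_ltn_trans szw; apply: leq_addl.
    rewrite -(IHn (fun z => g (sB (f (y :: u)) :: z)) v szv) //.
    exact: wmultilinear_cons.
  (* The inserted letter and its neighbours within the block are regrouped as cuts of one word [v];
     linearity of [G] in its first argument moves the sums inside. *)
  have Gl q := fstar_cons_linear f q gl.
  under eq_ssum => a r _ do
    rewrite (ssum1_ssum (fun b p q => G (f (map sA a ++ m b :: p)) q)).
  rewrite (ssum_assoc (fun a s q => ssum1 (fun b p => G (f (map sA a ++ m b :: p)) q) s)).
  rewrite ssumE [X in X + _]/= add0r.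
  apply: eq_ssum1 => y v q _; apply: etrans (esym (ssum_linear _ _ (Gl q))).
  by apply: eq_ssum => a r _; apply: esym (ssum1_linear _ _ (Gl q)).
rewrite [RHS]fstarE.
(* On the other side, [m'] either passes over the first letter [f u] or takes it as the start of its
   argument. *)
transitivity (ssum1 (fun u r => fstar f (coder sB m' (fun z => g (sB (f u) :: z))) r
    + fstar f (fun z => ssum1 (fun b c => g (m' b :: c)) (f u :: z)) r) (x :: w)).
  rewrite ssum1D; congr (_ + _).
  (* The blocks consumed by [m'] merge into one word [v], to which the hypothesis relating [m], [f]
     and [m'] applies. *)
  rewrite -(fstarE f (fun z => ssum1 (fun b c => g (m' b :: c)) z)) fstar_ssum1.
  apply: eq_ssum1 => y v q _; rewrite fm.
  exact: (fstar_linear f m' _ (fstar_cons_linear f q gl)).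
by apply: eq_ssum1 => y u r _; rewrite -fstarD; congr (fstar f _ r);
  apply/funext => z; rewrite coder_cons addrC.
Qed.

(** Refining each block of a coarse factorization is the same as grouping the blocks of a fine one.
    The induction removes the first coarse block. *)
Lemma fstar_comp (k : comPzRingType) (T : Type) (B C W : lmodType k)
    (f : seq T -> B) (f' : seq B -> C) (g : seq C -> W) w :
  wmultilinear g -> fstar (fstar f f') g w = fstar f (fstar f' g) w.
Proof.
have [n] := ubnP (size w); elim: n g w => // n IHn g [//|x w] szw gl.
rewrite fstarE.
transitivity (fstar f (fun z => ssum1 (fun b c => fstar f' (fun t => g (f' b :: t)) c) z)
    (x :: w)); last by apply: eq_fstar1 => y z; rewrite fstarE.
rewrite fstar_ssum1; apply: eq_ssum1 => y u v uv.
have szv : (size v < n)%N.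
  by rewrite -uv /= size_cat ltnS in szw; apply: leq_ltn_trans szw; apply: leq_addl.
rewrite (IHn _ v szv); last exact: wmultilinear_cons.
(* Multilinearity of [g] makes [h] linear, so [h] commutes with the sum over refinements of the
   first coarse block. *)
pose h c := fstar f (fstar f' (fun t => g (c :: t))) v.
apply: (@fstar_linear _ _ _ f _ _ h f') => a c d.
rewrite /h -fstarP; congr (fstar f _ v); apply/funext => z.
exact: (fstar_cons_linear f' z gl).
Qed.

(** * Graded words and suspension signs *)

Section LinearClosure.
Variables (k : comPzRingType) (U V W : lmodType k).

Lemma linear_comp (h : V -> W) (h' : U -> V) :
  linear h -> linear h' -> linear (fun x => h (h' x)).
Proof. by move=> hl hl' a x y; rewrite hl' hl. Qed.

Lemma linear_scalel (c : k) (h : U -> V) : linear h -> linear (fun x => c *: h x).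
Proof. by move=> hl a x y; rewrite hl scalerDr !scalerA mulrC. Qed.

Lemma linear_bigsum (I : Type) (r : seq I) (P : pred I) (h : I -> U -> V) :
  (forall i, P i -> linear (h i)) -> linear (fun x => \sum_(i <- r | P i) h i x).
Proof.
move=> hl a x y; rewrite scaler_sumr -big_split /=.
by apply: eq_bigr => i /hl ->.
Qed.

End LinearClosure.

Lemma expN1B (K : fieldType) (n m : nat) :
  (-1) ^ (n%:Z - m%:Z) = (-1) ^+ (n + m) :> K.
Proof.
rewrite expfzDr ?oppr_eq0 ?oner_neq0 // exprD; congr (_ * _).
by rewrite -exprnN -signr_odd invr_sign.
Qed.

Section Words.
Variables (k : fieldType) (A : gradedSpace k).
Implicit Types (u v w : seq A) (x y : A).

Lemma linear_homog_ext (W : lmodType k) (h1 h2 : A -> W) : linear h1 -> linear h2 ->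
  (forall i x, gr_homog i x -> h1 x = h2 x) -> h1 =1 h2.
Proof.
move=> l1 l2 E x; have [[s c] [/= _ hc ->]] := gr_decomp x.
elim: s => [|i s IHs]; first by rewrite big_nil !linear_at0.
by rewrite big_cons (linear_add l1) (linear_add l2) IHs (E i).
Qed.

(* The Koszul sign of the suspended degree |x| + 1. *)
Definition sgn x : A := - koszul 1 x.

Lemma sgn_linear : linear sgn.
Proof. by move=> a x y; rewrite /sgn koszul_linear opprD scalerN. Qed.

Lemma gr_homogZ i (a : k) x : gr_homog i x -> gr_homog i (a *: x).
Proof.
by move=> hx; rewrite -[_ *: _]addr0; apply: gr_homogP => //; apply: gr_homog0.
Qed.

Lemma gr_homogD i x y : gr_homog i x -> gr_homog i y -> gr_homog i (x + y).
Proof. by move=> hx hy; rewrite -[x]scale1r; apply: gr_homogP. Qed.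

Lemma sgn_homog i x : gr_homog i x -> sgn x = (-1) ^ (i + 1) *: x.
Proof.
move=> hx; rewrite /sgn (koszul_homog 1 hx) mul1r expfzDr ?oppr_eq0 ?oner_neq0 //.
by rewrite expr1z mulrN1 scaleNr.
Qed.

Lemma iter_sgn_homog n i x :
  gr_homog i x -> iter n sgn x = ((-1) ^ (i + 1)) ^+ n *: x.
Proof.
move=> hx; elim: n => [|n IHn]; first by rewrite scale1r.
by rewrite iterS IHn (linear_scale sgn_linear) (sgn_homog hx) scalerA exprSr.
Qed.

Lemma iter_sgn_linear n : linear (iter n sgn).
Proof. by elim: n => [|n IHn] a x y //=; rewrite IHn sgn_linear. Qed.

Lemma sgnK : involutive sgn.
Proof.
apply: linear_homog_ext => //; first exact: linear_comp sgn_linear sgn_linear.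
move=> i x hx; rewrite -[LHS]/(iter 2 sgn x) (iter_sgn_homog 2 hx).
by rewrite exprnP exprz_exp mulrC -exprz_exp -exprnP -signr_odd exp1rz scale1r.
Qed.

(** Expresses Koszul signs of degree [n - m] through the suspended sign [sgn]; the scalar corrects
    for |x| against |x| + 1. *)
Lemma koszulB (n m : nat) x :
  koszul (n%:Z - m%:Z) x = (-1) ^+ (n + m) *: iter (n + m) sgn x.
Proof.
move: x; apply: linear_homog_ext.
- exact: koszul_linear.
- exact/linear_scalel/iter_sgn_linear.
move=> i x hx; rewrite (koszul_homog _ hx) (iter_sgn_homog _ hx) scalerA.
rewrite -exprz_exp expN1B -exprMn expfzDr ?oppr_eq0 ?oner_neq0 // expr1z.
by rewrite mulrN1 mulrN mulN1r opprK !exprnP !exprz_exp mulrC.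
Qed.

Lemma koszul0 x : koszul 0 x = x.
Proof. by rewrite -[0 in LHS](subrr (0%:Z)) koszulB scale1r. Qed.

Inductive whomog : int -> seq A -> Prop :=
| whomog_nil : whomog 0 [::]
| whomog_cons e d x w : gr_homog e x -> whomog d w -> whomog (e + d) (x :: w).

Lemma whomog_cat d1 d2 u v : whomog d1 u -> whomog d2 v -> whomog (d1 + d2) (u ++ v).
Proof.
move=> hu hv; elim: hu => [|e d x w hx _ IH]; first by rewrite add0r.
by rewrite -addrA; apply: whomog_cons.
Qed.

Lemma whomog_split d u v : whomog d (u ++ v) ->
  exists d1 d2, [/\ d = d1 + d2, whomog d1 u & whomog d2 v].
Proof.
elim: u d => [|x u IHu] d /= hd.
  by exists 0, d; split=> //; [rewrite add0r|apply: whomog_nil].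
inversion hd as [|e d' x' w hx hw E1 [E2 E3]].
have [d1 [d2 [-> hu hv]]] := IHu _ hw.
by exists (e + d1), d2; split=> //; [rewrite addrA|apply: whomog_cons].
Qed.

Lemma whomog_degrees d w : whomog d w -> exists e : seq int,
  (forall i, (i < size w)%N -> gr_homog e`_i w`_i) /\ \sum_(i < size w) e`_i = d.
Proof.
elim=> [|e d' x w' hx _ [s [hs <-]]]; first by exists [::]; rewrite big_ord0.
by exists (e :: s); split=> [[|i] //|]; [apply: hs|rewrite big_ord_recl].
Qed.

Lemma whomog_image (I : Type) (e : I -> int) (v : I -> A) (r : seq I) :
  (forall i, gr_homog (e i) (v i)) -> whomog (\sum_(i <- r) e i) (map v r).
Proof.
move=> hv; elim: r => [|i r IHr] /=; first by rewrite big_nil; apply: whomog_nil.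
by rewrite big_cons; apply: whomog_cons.
Qed.

Lemma iter_sgn_gr n i x : gr_homog i x -> gr_homog i (iter n sgn x).
Proof. by move=> hx; rewrite (iter_sgn_homog n hx); apply: gr_homogZ. Qed.

(* The suspension signs: (s^{-1})^{\otimes n} turns x_1 ... x_n into
   \pm sgn^(n-1) x_1 ... sgn x_(n-1) x_n. *)
Fixpoint tw w : seq A := if w is x :: w' then iter (size w') sgn x :: tw w' else [::].

Lemma size_tw w : size (tw w) = size w.
Proof. by elim: w => //= x w ->. Qed.

Lemma tw_cat u v : tw (u ++ v) = map (iter (size v) sgn) (tw u) ++ tw v.
Proof.
by elim: u => //= x u ->; rewrite size_cat addnC iterD.
Qed.

Lemma iter_sgnK n : involutive (iter n sgn).
Proof.
by elim: n => // n IHn x; rewrite iterSr iterS sgnK IHn.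
Qed.

(** Each power of [sgn] is an involution, so the twist can be undone letter by letter. Identities
    may thus be tested on twisted words only. *)
Lemma tw_surj w : exists w', size w' = size w /\ tw w' = w.
Proof.
elim: w => [|x w [w' [sw Ew]]]; first by exists [::].
exists (iter (size w) sgn x :: w'); rewrite /= sw Ew; split=> //.
by rewrite iter_sgnK.
Qed.

Lemma tw_map_sgn w : tw (map sgn w) = map sgn (tw w).
Proof. by elim: w => //= x w ->; rewrite size_map -iterSr. Qed.

Lemma whomog_tw d w : whomog d (tw w) <-> whomog d w.
Proof.
elim: w d => //= x w IHw d; split=> h; inversion h as [|e d' x' w' hx hw E1 [E2 E3]].
  apply: whomog_cons; last exact/IHw.
  by rewrite -[x](iter_sgnK (size w)); apply: iter_sgn_gr.
apply: whomog_cons; last exact/IHw.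
exact: iter_sgn_gr.
Qed.

Lemma words_homog_ext (W : lmodType k) n (g1 g2 : seq A -> W) :
  (forall u v, (size u + (size v).+1 = n)%N -> linear (fun x => g1 (u ++ x :: v))) ->
  (forall u v, (size u + (size v).+1 = n)%N -> linear (fun x => g2 (u ++ x :: v))) ->
  (forall d w, size w = n -> whomog d w -> g1 w = g2 w) ->
  forall w, size w = n -> g1 w = g2 w.
Proof.
move=> l1 l2 E w sw.
(* Letters are made homogeneous from left to right; [u] is the part already treated. *)
suff H v u d : whomog d u -> size (u ++ v) = n -> g1 (u ++ v) = g2 (u ++ v).
  exact: (H w [::] 0 whomog_nil sw).
elim: v u d => [|x v IHv] u d hu; first by rewrite cats0 => su; apply: E su hu.
rewrite size_cat /= => suv.
apply: (linear_homog_ext (l1 _ _ suv) (l2 _ _ suv)) => i y hy.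
rewrite -cat_rcons; apply: (IHv _ (d + (i + 0))); last first.
  by rewrite size_cat size_rcons addSnnS.
by rewrite -cats1; apply: whomog_cat => //; apply: whomog_cons => //; apply: whomog_nil.
Qed.
End Words.

(** * Pure tensors as words *)

Section PureWords.
Variables (k : fieldType) (V : lmodType k).
Implicit Types (u v w : seq V).

(** Lists replace finite functions so that tensors concatenate by [++]; a list of another length is
    truncated or padded by the default [0] of [nth]. *)
Definition tword n w : tpow V n := tpure [ffun i : 'I_n => w`_i].

Lemma tword_linear n u v : (size u < n)%N -> linear (fun x => tword n (u ++ x :: v)).
Proof.
move=> un; pose i0 := Ordinal un.
have E x : tword n (u ++ x :: v) =
    tpure (upd [ffun i : 'I_n => (u ++ 0 :: v)`_i] i0 x).
  congr tpure; apply/ffunP => i; rewrite !ffunE -val_eqE /= !nth_cat.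
  case: eqP => [->|/eqP]; first by rewrite ltnn subnn.
  by case: ltngtP => // ui _; rewrite -(subnSK ui).
by move=> a x y; rewrite !E tpure_multilinear.
Qed.

Lemma tword_scale n (c : k) u v : (size u <= n)%N ->
  tword n (map ( *:%R c) u ++ v) = c ^+ size u *: tword n (u ++ v).
Proof.
elim/last_ind: u v => [|u x IHu] v; first by rewrite scale1r.
rewrite size_rcons => un; rewrite map_rcons !cat_rcons.
rewrite (linear_scale (@tword_linear n _ v _)) ?size_map // IHu ?(ltnW un) //.
by rewrite scalerA exprS.
Qed.

Lemma tword_scale_all n (c : k) u : (size u <= n)%N ->
  tword n (map ( *:%R c) u) = c ^+ size u *: tword n u.
Proof. by move=> un; rewrite -[map _ u]cats0 tword_scale // cats0. Qed.

Lemma tcat_tword p q u v : size u = p ->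
  tcat (tword p u) (tword q v) = tword (p + q) (u ++ v).
Proof.
move=> <-; rewrite tcat_pure; congr tpure; apply/ffunP => i; rewrite !ffunE nth_cat.
by case: splitP => j /= ->; rewrite ffunE ?addKn.

Qed.

Lemma tpow_cast_tword p n w : n = p -> tpow_cast p (tword n w) = tword p w.
Proof.
move=> <-; rewrite /tpow_cast; case: eqP => // e.
by rewrite (eq_axiomK e).
Qed.

Lemma tpow_cast_linear p n : linear (@tpow_cast k V n p).
Proof.
rewrite /tpow_cast; case: eqP => [e|_] a x y; last by rewrite scaler0 addr0.
by case: _ / e.
Qed.

Lemma tone_tword x : tone x = tword 1 [:: x].
Proof. by congr tpure; apply/ffunP => i; rewrite !ffunE ord1. Qed.

Lemma tone_linear : linear (@tone k V).
Proof.
move=> a x y; rewrite !tone_tword.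
by rewrite (@tword_linear 1 [::] [::]).
Qed.

Lemma tpure_tword n (v : {ffun 'I_n -> V}) : tpure v = tword n [seq v i | i <- enum 'I_n].
Proof.
congr tpure; apply/ffunP => i; rewrite ffunE (nth_map i) ?size_enum_ord //.
by rewrite nth_ord_enum.
Qed.

Lemma tpow_linear_ext (W : lmodType k) n (h1 h2 : tpow V n -> W) :
  linear h1 -> linear h2 -> (forall w, size w = n -> h1 (tword n w) = h2 (tword n w)) ->
  h1 =1 h2.
Proof.
move=> l1 l2 E; elim/tpow_ind => [|a v x IHx]; first by rewrite !linear_at0.
by rewrite l1 l2 IHx tpure_tword E // size_map size_enum_ord.
Qed.

End PureWords.

(** * Koszul tensor products evaluated on words *)

Section GradedWords.
Variables (k : fieldType) (A : gradedSpace k).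
Implicit Types (u v w : seq A) (x y : A).

Lemma tword_homog n d w : size w = n -> whomog d w -> tpow_homog d (tword n w).
Proof.
move=> <- /whomog_degrees[e [he <-]].
by apply: (@tpow_homog_pure _ _ _ _ (fun i => e`_i)) => // i; rewrite ffunE; apply: he.
Qed.

Lemma tpow_homog_words n d (P : tpow A n -> Prop) :
  P 0 -> (forall a (x y : tpow A n), P x -> P y -> P (a *: x + y)) ->
  (forall w, size w = n -> whomog d w -> P (tword n w)) ->
  forall x : tpow A n, tpow_homog d x -> P x.
Proof.
move=> P0 PD Pw x; elim=> [//|a u v _ Pu _ Pv|e v hv ev]; first exact: PD.
rewrite tpure_tword; apply: Pw; first by rewrite size_map size_enum_ord.
by rewrite -ev -big_enum; apply: whomog_image.
Qed.

Lemma tword_koszul n c d w : size w = n -> whomog d w ->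
  tword n (map (koszul c) w) = (-1) ^ (c * d) *: tword n w.
Proof.
suff E u w' : (size u + size w' <= n)%N -> forall d', whomog d' w' ->
    tword n (u ++ map (koszul c) w') = (-1) ^ (c * d') *: tword n (u ++ w').
  by move=> sw; apply: (E [::]); rewrite sw.
move=> un d' hw; elim: hw u un => [|e d1 x w1 hx _ IH] u.
  by rewrite mulr0 expr0z scale1r.
rewrite /= addnS => un; have un' := leq_ltn_trans (leq_addr _ _) un.
rewrite (koszul_homog c hx) (linear_scale (tword_linear _ un')) -!cat_rcons IH.
  by rewrite scalerA mulrDr expfzDr // oppr_eq0 oner_eq0.
by rewrite size_rcons.
Qed.

Lemma tword_sgn n d w : size w = n -> whomog d w ->
  tword n (map (@sgn k A) w) = (-1) ^ (d + n%:Z) *: tword n w.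
Proof.
move=> sw hw; have -> : map (@sgn k A) w = map ( *:%R (-1)) (map (koszul 1) w).
  by rewrite -map_comp; apply: eq_map => x /=; rewrite scaleN1r.
rewrite tword_scale_all ?size_map ?sw // (tword_koszul 1 sw hw) scalerA.
by rewrite mul1r mulrC expfzDr // oppr_eq0 oner_eq0.
Qed.

Section Gtens.
Variables (W : lmodType k) (p q p' q' : nat).
Variables (f : tpow A p -> tpow W p') (d : int) (g : tpow A q -> tpow W q').
Hypotheses (f_lin : linear f) (g_lin : linear g).

(** With the sign spread over the letters of [u], both sides are linear in each of them, so
    homogeneous letters suffice and [gtens_koszul] applies. *)
Lemma gtens_tword u v : size u = p ->
  gtens f d g (tword (p + q) (u ++ v)) =
  tcat (f (tword p (map (koszul d) u))) (g (tword q v)).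
Proof.
apply: (words_homog_ext (g1 := fun u => gtens f d g (tword (p + q) (u ++ v)))
  (g2 := fun u => tcat (f (tword p (map (koszul d) u))) (g (tword q v)))).
- move=> a b ab; apply: linear_comp; first exact: gtens_linear.
  move=> c x y; rewrite -!catA /=; apply: tword_linear.
  by rewrite -ab addnS addSn ltnS -addnA leq_addr.
- move=> a b ab; apply: linear_comp; first exact: tcat_linearl.
  apply: linear_comp => // c x y; rewrite !map_cat /= koszul_linear.
  by apply: tword_linear; rewrite size_map -ab addnS ltnS leq_addr.
move=> e w sw hw; rewrite -tcat_tword // (gtens_koszul _ _ _ _ (tword_homog sw hw)) //.
rewrite (tword_koszul d sw hw) (linear_scale f_lin).
by rewrite (linear_scale (tcat_linearl _)).
Qed.
End Gtens.

Lemma map_koszulB n m u :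
  map (@koszul k A (n%:Z - m%:Z)) u =
  map ( *:%R ((-1) ^+ (n + m))) (map (iter (n + m) (@sgn k A)) u).
Proof. by rewrite -map_comp; apply: eq_map => x /=; rewrite koszulB. Qed.

Lemma tens_insert_tword r s t d (g : tpow A s -> A) u v w :
  linear g -> size u = r -> size v = s ->
  tens_insert r s t d g (tword (r + (s + t)) (u ++ v ++ w)) =
  tword (r + (1 + t)) (map (koszul d) u ++ g (tword s v) :: w).
Proof.
move=> gl su sv; have tl := linear_comp (@tone_linear k A) gl.
rewrite /tens_insert gtens_tword //; last exact: gtens_linear.
rewrite gtens_tword // (eq_map (@koszul0 k A)) map_id tone_tword !tcat_tword //.
by rewrite size_map.
Qed.

(** Up to an overall sign and the identification of [A] with its suspension, this precomposes [g]
    with desuspension; all arities are joined into one function of words. *)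
Definition hat (W : Type) (g : forall n, tpow A n -> W) w : W :=
  g (size w) (tword (size w) (tw w)).

Lemma hatE (W : Type) (g : forall n, tpow A n -> W) n w :
  size w = n -> hat g w = g n (tword n (tw w)).
Proof. by move=> <-. Qed.

Lemma hat_wmultilinear (W : lmodType k) (g : forall n, tpow A n -> W) :
  (forall n, (1 <= n)%N -> linear (g n)) -> wmultilinear (hat g).
Proof.
move=> gl u v; pose n := (size u + (size v).+1)%N.
suff l : linear (fun x => g n (tword n (tw (u ++ x :: v)))).
  by move=> a x y; rewrite !(@hatE _ g n) ?size_cat //; apply: l.
apply: linear_comp; first by apply: gl; rewrite /n addnS.
move=> a x y; rewrite !tw_cat /= iter_sgn_linear.
by apply: tword_linear; rewrite size_map size_tw /n addnS ltnS leq_addr.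
Qed.

End GradedWords.

(** * Commutation of graded maps with the sign automorphism *)

Section DegreeWords.
Variables (k : fieldType) (A B : gradedSpace k) (f : forall n, tpow A n -> B) (c : nat).
Hypothesis f_lin : forall n, (1 <= n)%N ->
  linear (@f n) /\ has_degree (@f n) (n%:Z - c%:Z).

(* f_n has degree n - c, hence degree 1 - c with respect to the suspended degrees *)
Lemma sgn_tword n w : (1 <= n)%N -> size w = n ->
  @f n (tword n (map (@sgn k A) w)) = (-1) ^+ c.+1 *: sgn (@f n (tword n w)).
Proof.
move=> n1; have [fl fd] := f_lin n1.
apply: (words_homog_ext (g1 := fun w => @f n (tword n (map (@sgn k A) w)))
  (g2 := fun w => (-1) ^+ c.+1 *: sgn (@f n (tword n w)))).
- move=> a b ab; apply: linear_comp => // z x y; rewrite !map_cat /= sgn_linear.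
  by apply: tword_linear; rewrite size_map -ab addnS ltnS leq_addr.
- move=> a b ab; apply/linear_scalel/linear_comp; first exact: sgn_linear.
  apply: linear_comp => //.
  by apply: tword_linear; rewrite -ab addnS ltnS leq_addr.
move=> d {}w sw hw; rewrite (tword_sgn sw hw) (linear_scale fl).
rewrite (sgn_homog (fd _ _ (tword_homog sw hw))) scalerA; congr (_ *: _).
have N1 : (-1 : k) != 0 by rewrite oppr_eq0 oner_eq0.
have -> : d + (n%:Z - c%:Z) + 1 = d + n%:Z + (1%:Z - c%:Z).
  by rewrite addrA -!addrA [- _ + 1]addrC.
rewrite [in RHS]expfzDr //.
by rewrite (expN1B k 1 c) mulrC -mulrA add1n -expr2 sqrr_sign mulr1.
Qed.

Lemma hat_iter_sgn j w : (1 <= size w)%N ->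
  @f (size w) (tword (size w) (map (iter j (@sgn k A)) (tw w))) =
  (-1) ^+ (j * c.+1) *: iter j (@sgn k B) (hat (@f) w).
Proof.
move=> w1; elim: j => [|j IHj].
  by rewrite mul0n scale1r (eq_map (g := id)) // map_id.
rewrite (_ : map _ _ = map (@sgn k A) (map (iter j (@sgn k A)) (tw w))); last first.
  by rewrite -map_comp.
rewrite sgn_tword ?size_map ?size_tw // IHj (linear_scale (@sgn_linear k B)).
by rewrite scalerA -exprD mulSn.
Qed.

(** For [c = 1] (morphisms) the signs commute with [hat f]; for [c = 2] (structure maps) they
    anticommute. *)
Lemma hat_map_sgn x w :
  hat (@f) (map (@sgn k A) (x :: w)) = (-1) ^+ c.+1 *: sgn (hat (@f) (x :: w)).
Proof.
rewrite (hatE (@f) (size_map _ (x :: w))) tw_map_sgn.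
by rewrite sgn_tword ?size_tw.
Qed.

Lemma hat_homog d x w : whomog d (x :: w) ->
  gr_homog (d + (size (x :: w))%:Z - c%:Z) (hat (@f) (x :: w)).
Proof.
move=> hw; have [//|_ fd] := @f_lin (size (x :: w)).
by rewrite -addrA; apply: fd; apply: tword_homog; [rewrite size_tw|apply/whomog_tw].
Qed.

End DegreeWords.

(** * The A-infinity equations on words *)

(** A new first part [a] adds [a] times the sum of the i_k - 1, which has the parity of
    [sumn i + size i]. Positivity of the parts makes the truncated predecessor exact. *)
Lemma lsign_cons a (i : seq nat) : all (leq 1) i ->
  odd (lsign (a :: i)) = odd (a * (sumn i + size i) + lsign i)%N.
Proof.
move=> i1; rewrite /lsign /= big_ord_recl big1 ?add0n; last by case.
rewrite [X in odd X = _](eq_bigr (fun j : 'I_(size i) => ((nth 0 i j).-1 * a +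
    \sum_(l < size i | l < j) (nth 0 i j).-1 * nth 0 i l)%N)); last first.
  by move=> j _; rewrite big_mkcond /= big_ord_recl /= [in RHS]big_mkcond.
rewrite big_split /= !oddD; congr (_ (+) _).
rewrite -big_distrl /= mulnC !oddM; congr (_ && _).
have -> : (\sum_(j < size i) (nth 0 i j).-1 = \sum_(x <- i) x.-1)%N.
  by rewrite (big_nth 0%N) big_mkord.
elim: i i1 => [|x i IHi] /=; first by rewrite big_nil.
case: x => // x /IHi; rewrite big_cons !(oddD, oddS) /= => ->.
by case: (odd x); case: (odd (sumn i)); case: (odd (size i)).
Qed.

(** * Tensor products of morphism components on words *)

Section TensSeqWords.
Variables (k : fieldType) (A B : gradedSpace k) (f : forall n, tpow A n -> B).
Hypothesis f_lin : forall n, (1 <= n)%N ->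
  linear (@f n) /\ has_degree (@f n) (n%:Z - 1%:Z).

Lemma tens_seq_linear i : all (leq 1) i -> linear (tens_seq (@f) i).
Proof.
elim: i => [|a i IHi] /=; first by move=> _; apply: tlift_linear => v [].
case/andP=> a1 /IHi il.
apply: (@gtens_linear _ _ _ _ _ 1 (size i) _ _ _ _ il).
by apply: linear_comp; [apply: tone_linear|case: (f_lin a1)].
Qed.

(** The sign l(i_1, ..., i_r) is exactly what the Koszul rule produces when desuspensions are moved
    through the tensor product. *)
Lemma tens_seq_tword us : all (leq 1) (shape us) ->
  tens_seq (@f) (shape us) (tword (sumn (shape us)) (tw (flatten us))) =
  (-1) ^+ lsign (shape us) *: tword (size (shape us)) (tw (map (hat (@f)) us)).
Proof.
elim: us => [|u us IHus] /=.
  move=> _; rewrite tlift_pure; last by move=> v [].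
  rewrite /lsign /= big_ord0 scale1r; congr tpure.
  by apply/ffunP => -[].
case/andP=> u1 us1; have [fl fd] := f_lin u1.
rewrite tw_cat.
have -> : \sum_(j <- shape us) (j%:Z - 1) = (sumn (shape us))%:Z - (size us)%:Z.
  elim: (us) => [|v vs IHvs] /=; first by rewrite big_nil subrr.
  by rewrite big_cons IHvs PoszD -[in RHS]add1n PoszD opprD addrACA.
set N := sumn (shape us); set r := size us.
rewrite gtens_tword ?size_map ?size_tw //; last exact: tens_seq_linear.
  rewrite map_koszulB -/r.
  rewrite tword_scale_all ?size_map ?size_tw //.
  (* Of the [N + r] Koszul twists, [N] cancel those that [tw] puts on [u]; the other [r] are the
     twist required in front of [r] output letters. *)
  have -> : map (iter (N + r) (@sgn k A))
      (map (iter (size (flatten us)) (@sgn k A)) (tw u))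
      = map (iter r (@sgn k A)) (tw u).
    rewrite -map_comp; apply: eq_map => x /=.
    by rewrite size_flatten -/N addnC iterD iter_sgnK.
  rewrite (linear_scale fl) (hat_iter_sgn f_lin) //.
  rewrite (_ : (-1) ^+ (r * 2) = 1) ?scale1r; last first.
    by rewrite -signr_odd oddM andbF.
  rewrite IHus // (linear_scale (@tone_linear _ _)).
  rewrite (linear_scale (tcat_linearl _)) (linear_scale (tcat_linearr _)).
  rewrite tone_tword tcat_tword // scalerA; congr (_ *: _).
  by rewrite -exprM -exprD -[RHS]signr_odd lsign_cons // signr_odd size_map mulnC.
by apply: linear_comp; [apply: tone_linear|].
Qed.

End TensSeqWords.

(** * Cuts indexed by position, and Stasheff sums as coderivations *)

Section IndexSum.
Variables (T : Type) (W : nmodType).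
Implicit Types (F : seq T -> seq T -> W) (w : seq T).

Lemma ssum_index F w : ssum F w = \sum_(i < (size w).+1) F (take i w) (drop i w).
Proof.
elim: w F => [|x w IHw] F /=; first by rewrite big_ord_recl big_ord0 addr0.
by rewrite big_ord_recl IHw.
Qed.

Lemma ssum1_index F w :
  ssum1 F w = \sum_(i < (size w).+1 | (0 < i)%N) F (take i w) (drop i w).
Proof.
case: w => [|x w] /=; first by rewrite big_mkcond /= big_ord_recl big_ord0 addr0.
by rewrite big_mkcond /= big_ord_recl add0r ssum_index.
Qed.

End IndexSum.

Section StasheffWords.
Variables (k : fieldType) (A : gradedSpace k) (m : forall n, tpow A n -> A).
Hypothesis m_lin : forall n, (1 <= n)%N ->
  linear (@m n) /\ has_degree (@m n) (n%:Z - 2%:Z).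
Variables (W : lmodType k) (g : forall n, tpow A n -> W).
Hypothesis g_lin : forall n, (1 <= n)%N -> linear (@g n).

Lemma stasheff_sum_linear n : linear (@stasheff_sum k A W m g n).
Proof.
rewrite /stasheff_sum; apply: linear_bigsum => r _; apply: linear_bigsum => s _.
apply: linear_bigsum => t /andP[s0 _].
apply: linear_scalel; apply: linear_comp.
  by apply: g_lin; rewrite addnA addn1 addSn.
apply: linear_comp; last exact: tpow_cast_linear.
apply: gtens_linear => //; apply: gtens_linear => //.
by apply: linear_comp; [apply: tone_linear|case: (m_lin s0)].
Qed.

(** The sign (-1)^(rs + t) cancels the Koszul sign of moving [m] past [u] and the sign of moving the
    [size w] twists on [v] through [m]. *)
Lemma stasheff_term u v w : (1 <= size v)%N ->
  (-1) ^+ (size u * size v + size w)%N *: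
    g (tens_insert (size u) (size v) (size w) ((size v)%:Z - 2) (@m (size v))
         (tword (size u + (size v + size w)) (tw (u ++ v ++ w)))) =
  hat (@g) (map (@sgn k A) u ++ hat (@m) v :: w).
Proof.
move=> v1; have [ml md] := m_lin v1.
have gl : linear (@g (size u + (1 + size w))) by apply: g_lin; rewrite addnA addn1 addSn.
rewrite !tw_cat size_cat tens_insert_tword ?size_map ?size_tw //.
rewrite (map_koszulB (size v) 2) tword_scale ?size_map ?size_tw ?leq_addr //.
rewrite (hat_iter_sgn m_lin) // (linear_scale gl) scalerA.
have uw : (size u < size u + (1 + size w))%N by rewrite add1n addnS ltnS leq_addr.
rewrite (linear_scale (tword_linear _ _)) ?size_map ?size_tw // (linear_scale gl) scalerA.
rewrite (hatE (@g) (n := (size u + (1 + size w))%N)) ?size_cat ?size_map //.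
(* With r, s, t the three lengths, the total exponent is (rs + t) + (s + 2)r + 3t, which is even. *)
rewrite tw_cat tw_map_sgn -exprM -!exprD -signr_odd !(oddD, oddM) /= !andbT.
rewrite addbF [odd (size v) && _]andbC (_ : _ (+) _ = false) ?scale1r; last first.
  by case: (odd (size u) && _); case: (odd (size w)).
congr (g (tword _ (_ ++ _))); rewrite -!map_comp; apply: eq_map => x /=.
(* A letter of [u] carries (s + 2) + (s + t) twists on the left and t + 2 on the right; they differ
   by an even number. *)
by rewrite -!iterSr -iterD -addnA (addnCA 2%N) !iterD iter_sgnK.
Qed.

Lemma hat_stasheff w :
  stasheff_sum (@m) (@g) (tword (size w) (tw w)) =
  coder (@sgn k A) (hat (@m)) (hat (@g)) w.
Proof.
rewrite /coder ssum_index; apply: eq_bigr => r _.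
rewrite ssum1_index size_drop; have rw : (r <= size w)%N by rewrite -ltnS.
rewrite (big_ord_widen_cond (size w).+1 (fun s => (0 < s)%N)
  (fun s => hat (@g) (map (@sgn k A) (take r w) ++
     hat (@m) (take s (drop r w)) :: drop s (drop r w)))); last by rewrite ltnS leq_subr.
rewrite [RHS]big_mkcond; apply: eq_bigr => s _.
case: ifP => [/andP[s0 sr]|sr]; last first.
  rewrite big1 // => t /andP[s0 /eqP rst].
  have rsw := leq_addr t (r + s)%N; rewrite rst in rsw.
  by rewrite s0 ltnS leq_subRL // rsw in sr.
rewrite ltnS in sr; pose t := (size w - r - s)%N.
have tw' : (t < (size w).+1)%N by rewrite ltnS /t -subnDA leq_subr.
have rst : (r + (s + t) = size w)%N by rewrite /t subnKC // subnKC.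
(* Once r and s are fixed, the condition on the lengths leaves a single value of t. *)
rewrite (big_pred1 (Ordinal tw')) => [|t']; last first.
  transitivity (r + s + t' == r + (s + t))%N; first by rewrite rst s0.
  by rewrite -addnA !eqn_add2l.
rewrite tpow_cast_tword //=.
have Er : size (take r w) = r by rewrite size_takel.
have Es : size (take s (drop r w)) = s by rewrite size_takel // size_drop.
have Et : size (drop s (drop r w)) = t by rewrite !size_drop.
rewrite -stasheff_term ?Es //.
by rewrite !cat_take_drop Er Et.
Qed.

End StasheffWords.

(* The compositions of p + n with first part at least p. *)
Fixpoint compositions (p n : nat) : seq (seq nat) :=
  if n is n'.+1 then compositions p.+1 n' ++ map (cons p) (compositions 1 n')
  else [:: [:: p]].

Lemma mem_compositions p n i : (i \in compositions p n) =
  if i is q :: i' then [&& (p <= q)%N, all (leq 1) i' & (q + sumn i' == p + n)%N]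
  else false.
Proof.
elim: n p i => [|n IHn] p i /=.
  rewrite inE addn0; case: i => // q i; rewrite eqseq_cons.
  apply/andP/and3P => [[/eqP-> /eqP->]|[pq i1 /eqP E]]; first by rewrite /= addn0.
  have qp : q = p by apply/eqP; rewrite eqn_leq pq -E leq_addr.
  split; first exact/eqP.
  move: E; rewrite qp -[RHS]addn0 => /addnI.
  by case: i i1 => //= -[|a] i.
rewrite mem_cat IHn; case: i => [|q i].
  by apply/mapP => -[].
case: (ltngtP p q) => [pq|qp|<-].
- rewrite addSnnS /= -[RHS]orbF; congr (_ || _); apply/mapP => -[j _ [qp _]].
  by rewrite qp ltnn in pq.
- by rewrite /=; apply/mapP => -[j _ [pq _]]; rewrite pq ltnn in qp.
rewrite /= mem_map; last by move=> j j' [].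
rewrite IHn eqn_add2l; case: i => [|a i] //=.
by rewrite add1n andbA.
Qed.

Lemma uniq_compositions p n : uniq (compositions p n).
Proof.
elim: n p => //= n IHn p; rewrite cat_uniq IHn map_inj_uniq ?IHn ?andbT /=; last first.
  by move=> j j' [].
apply/hasPn => _ /mapP[j _ ->].
by rewrite mem_compositions ltnn.
Qed.

(** Both recursions agree: lengthening the open block raises the lower bound on the first part, and
    closing it fixes that part. *)
Lemma blk_compositions (T T' : Type) (W : nmodType) (f : seq T -> T')
    (g : seq T' -> W) u w :
  blk f g u w = \sum_(i <- compositions (size u) (size w)) g (map f (reshape i (u ++ w))).
Proof.
elim: w g u => [|x w IHw] g u /=; first by rewrite big_seq1 /= cats0 take_size.
rewrite big_cat big_map /= !IHw size_rcons cat_rcons; congr (_ + _).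
by apply: eq_bigr => i _; rewrite /= take_size_cat ?drop_size_cat.
Qed.

Lemma sum_tuple_compositions (W : nmodType) n (F : seq nat -> W) :
  \sum_(r < n.+2 | (0 < r)%N)
    \sum_(c : r.-tuple 'I_n.+2 |
        let i := [seq val j | j <- c] in all (leq 1) i && (sumn i == n.+1)%N)
      F [seq val j | j <- c] =
  \sum_(i <- compositions 1 n) F i.
Proof.
pose P (i : seq nat) := all (leq 1) i && (sumn i == n.+1).
have memP i : (i \in compositions 1 n) = P i.
  rewrite mem_compositions /P add1n; case: i => [|q i] //=.
  by rewrite andbA.
(* A composition of [n.+1] has at most [n.+1] parts, each at most [n.+1], so tuples over ['I_n.+2]
   miss none. *)
have bounds i : P i -> (size i < n.+2)%N /\ all (fun j => j < n.+2)%N i.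
  case/andP=> i1 /eqP <-; elim: i i1 => //= a i IHi /andP[a1 /IHi[si ai]].
  split; first by have := leq_add a1 si; rewrite add1n !addnS.
  apply/andP; split; first by rewrite ltnS leq_addr.
  by apply: sub_all ai => j /leq_trans; apply; rewrite ltnS leq_addl.
pose L := compositions 1 n.
transitivity (\sum_(r < n.+2) \sum_(i <- L | size i == r) F i); last first.
  rewrite (exchange_big_dep xpredT) //= big_seq [RHS]big_seq.
  apply: eq_bigr => i; rewrite memP => /bounds[si _].
  by rewrite (big_pred1 (Ordinal si)) // => r; rewrite eq_sym.
rewrite big_mkcond; apply: eq_bigr => r _; case: ifP => r0; last first.
  rewrite big_seq_cond big1 // => i; rewrite mem_compositions => /andP[+ /eqP ir].
  by case: i ir => // a i ir; rewrite -ir in r0.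
rewrite -[RHS]big_filter.
pose h (c : r.-tuple 'I_n.+2) := [seq val j | j <- c].
rewrite -(big_map h P F) -big_filter; apply: perm_big; apply: uniq_perm.
- rewrite filter_uniq // map_inj_uniq ?index_enum_uniq // => c c' /inj_map E.
  by apply/val_inj/E/val_inj.
- by rewrite filter_uniq ?uniq_compositions.
move=> i; rewrite !mem_filter memP andbC; case Pi: (P i); rewrite ?andbF // !andbT.
apply/mapP/eqP => [[c _ ->]|ir]; first by rewrite size_map size_tuple.
have [_ /allP ai] := bounds _ Pi.
have sz : size [seq inord j : 'I_n.+2 | j <- i] == r by rewrite size_map ir.
exists (Tuple sz); first by rewrite mem_index_enum.
rewrite /h /= -map_comp -[LHS]map_id; apply/eq_in_map => j /ai jn /=.
by rewrite inordK.
Qed.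

(** * Composition of families as [fstar] *)

Section CompositionWords.
Variables (k : fieldType) (A B : gradedSpace k) (f : forall n, tpow A n -> B).
Hypothesis f_lin : forall n, (1 <= n)%N ->
  linear (@f n) /\ has_degree (@f n) (n%:Z - 1%:Z).
Variables (W : lmodType k) (g : forall n, tpow B n -> W).
Hypothesis g_lin : forall n, (1 <= n)%N -> linear (@g n).

Lemma ainf_comp_linear n : linear (@ainf_comp k A B W g f n).
Proof.
rewrite /ainf_comp; apply: linear_bigsum => r r0; apply: linear_bigsum => c /andP[c1 _].
apply: linear_scalel; apply: linear_comp.
  by apply: g_lin; rewrite size_map size_tuple.
by apply: linear_comp; [apply: tens_seq_linear|apply: tpow_cast_linear].
Qed.

Lemma hat_ainf_comp x w :
  hat (@ainf_comp k A B W g f) (x :: w) = fstar (hat (@f)) (hat (@g)) (x :: w).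
Proof.
rewrite [LHS]/hat /ainf_comp.
rewrite (sum_tuple_compositions (size w) (fun i => (-1) ^+ lsign i *:
  g (tens_seq (@f) i (tpow_cast (sumn i) (tword (size w).+1 (tw (x :: w))))))).
rewrite [RHS]blk_compositions /= big_seq [RHS]big_seq; apply: eq_bigr => i.
rewrite mem_compositions => iP.
have [i0 i1 /eqP si] : [/\ (0 < size i)%N, all (leq 1) i & sumn i == (size w).+1].
  by case: i iP => // a i /and3P[a1 i1 si]; split=> //=; rewrite a1.
have sh : shape (reshape i (x :: w)) = i by apply: reshapeKl; rewrite si.
have fl : flatten (reshape i (x :: w)) = x :: w by apply: reshapeKr; rewrite si.
have := @tens_seq_tword _ _ _ f f_lin (reshape i (x :: w)).
rewrite sh fl tpow_cast_tword // => -> //.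
(* The sign in the definition of the composite meets the equal sign from [tens_seq_tword], and their
   product is 1. *)
rewrite (linear_scale (g_lin i0)) scalerA -expr2 sqrr_sign scale1r.
by rewrite (@hatE _ _ _ g (size i)) // size_map -[in RHS]sh size_map.
Qed.

End CompositionWords.

(** The integer [c] must vary in the induction, because fixing the first block as an argument of [g]
    shifts its degree. *)
Lemma fstar_homog (k : fieldType) (A B C : gradedSpace k) (f : seq A -> B)
    (g : seq B -> C) (c : int) d x w :
  (forall d x w, whomog d (x :: w) ->
     gr_homog (d + (size (x :: w))%:Z - 1) (f (x :: w))) ->
  (forall d y z, whomog d (y :: z) ->
     gr_homog (d + (size (y :: z))%:Z + c) (g (y :: z))) ->
  whomog d (x :: w) -> gr_homog (d + (size (x :: w))%:Z + c) (fstar f g (x :: w)).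
Proof.
move=> fh; have [n] := ubnP (size (x :: w)).
elim: n x w g c d => // n IHn x w g c d szw gh hw.
rewrite fstarE /=.
have S (F : seq A -> seq A -> C) v e : (forall a b, a ++ b = v -> gr_homog e (F a b)) ->
    gr_homog e (ssum F v).
  elim: v F => [|y v IHv] F Fh /=; first exact: Fh.
  by apply: gr_homogD; [apply: Fh|apply: IHv => a b ab; apply: Fh; rewrite -ab].
apply: S => u v uv; move: hw; rewrite -uv -cat_cons => /whomog_split[d1 [d2 [-> hu hv]]].
have {}hu := fh _ _ _ hu.
(* The degree d1 + (size u).+1 - 1 of [f (x :: u)], plus 1 for the additional letter, plus [c]. *)
pose c' : int := d1 + (size u).+1%:Z + c.
have Gh e z : whomog e z -> gr_homog (e + (size z)%:Z + c') (g (f (x :: u) :: z)).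
  move=> hz; have := gh _ _ _ (whomog_cons hu hz).
  by congr (gr_homog _ _); rewrite /c' /=; lia.
have -> : d1 + d2 + (size ((x :: u) ++ v))%:Z + c = d2 + (size v)%:Z + c'.
  by rewrite size_cat /c' /=; lia.
case: v uv hv => [|y v] uv hv.
  have -> : d2 = 0 by inversion hv.
  exact: (Gh 0 [::] (whomog_nil _)).
apply: (IHn y v (fun z => g (f (x :: u) :: z)) c' d2) => [|e z t|//]; last exact: Gh.
by move: szw; rewrite /= -uv size_cat /=; lia.
Qed.

Lemma tpow_tw_ext (k : fieldType) (A : gradedSpace k) (W : lmodType k) n
    (h1 h2 : tpow A n.+1 -> W) :
  linear h1 -> linear h2 ->
  (forall x w, size w = n ->
     h1 (tword n.+1 (tw (x :: w))) = h2 (tword n.+1 (tw (x :: w)))) ->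
  h1 =1 h2.
Proof.
move=> l1 l2 E; apply: tpow_linear_ext => // w sw.
have [[|x w'] [sw' <-]] := tw_surj w; first by rewrite sw in sw'.
by apply: E; move: sw'; rewrite sw => -[].
Qed.

Theorem proposition5p10 (k : fieldType) (A A' A'' : gradedSpace k)
    (m : forall n : nat, tpow A n -> A)
    (m' : forall n : nat, tpow A' n -> A')
    (m'' : forall n : nat, tpow A'' n -> A'')
    (f : forall n : nat, tpow A n -> A')
    (f' : forall n : nat, tpow A' n -> A'') :
  is_ainf_algebra m -> is_ainf_algebra m' -> is_ainf_algebra m'' ->
  is_ainf_morphism m m' f -> is_ainf_morphism m' m'' f' ->
  is_ainf_morphism m m'' (ainf_comp f' f).
Proof.
move=> [m_lin _] [m'_lin _] [m''_lin _] [f_lin fm] [f'_lin f'm].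
have f'l n (n1 : (1 <= n)%N) : linear (f' n) by case: (f'_lin n n1).
have m'l n (n1 : (1 <= n)%N) : linear (m' n) by case: (m'_lin n n1).
have m''l n (n1 : (1 <= n)%N) : linear (m'' n) by case: (m''_lin n n1).
have F_lin n : (1 <= n)%N ->
    linear (@ainf_comp _ _ _ _ f' f n) /\
    has_degree (@ainf_comp _ _ _ _ f' f n) (n%:Z - 1).
  move=> n1; have Fl := ainf_comp_linear f_lin f'l (n := n); split=> // d.
  apply: tpow_homog_words => [|a x y hx hy|w sw hw].
  - by rewrite (linear_at0 Fl); apply: gr_homog0.
  - by rewrite Fl; apply: gr_homogP.
  (* Writing the homogeneous word as a twisted one turns the composite into
     [fstar (hat f) (hat f')]. *)
  have [[|x v] [sv tv]] := tw_surj w; first by rewrite -sw -sv in n1.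
  rewrite -tv -(hatE (@ainf_comp _ _ _ _ f' f)) ?sv // hat_ainf_comp //.
  rewrite addrA -sw -sv; apply: fstar_homog.
  - exact: hat_homog.
  - exact: hat_homog.
  - by apply/whomog_tw; rewrite tv.
split=> // -[//|n] _.
apply: tpow_tw_ext => [||x w <-].
- by apply: stasheff_sum_linear => // j j1; case: (F_lin j j1).
- by apply: ainf_comp_linear.
have /= -> := hat_stasheff m_lin (fun j j1 => proj1 (F_lin j j1)) (x :: w).
have /= E := hat_ainf_comp F_lin m''l x w.
rewrite [RHS]E.
transitivity (coder (@sgn k A) (hat m) (fstar (hat f) (hat f')) (x :: w)).
  by apply: eq_coder => // y u; apply: hat_ainf_comp.
(* The coderivation is moved past [f], where [m] becomes [m']; the equation for [f'] then applies
   under [fstar (hat f)]. *)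
rewrite (@coder_fstar _ _ _ _ _ (@sgn k A') _ (hat m')).
- transitivity (fstar (hat f) (fstar (hat f') (hat m'')) (x :: w)).
    apply: eq_fstar1 => y z; rewrite -hat_ainf_comp //.
    by rewrite -hat_stasheff // f'm.
  (* Functoriality of [fstar] reassembles the composite on the side of [m'']. *)
  rewrite -fstar_comp; last exact: hat_wmultilinear.
  by apply: eq_fstar => y u; rewrite hat_ainf_comp.
- by move=> y u; rewrite (hat_map_sgn f_lin) sqrrN expr1n scale1r.
- move=> y u; rewrite -hat_ainf_comp // -hat_stasheff ?fm // => j j1.
  by case: (f_lin j j1).
exact: hat_wmultilinear.
Qed.
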